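(* Let $(M,\eta,\xi,g,\Phi)$ be a contact Lorentzian $3$-manifold and let $\alpha:I\to M$ be a non-geodesic magnetic whirl curve, i.e. a non-geodesic Frenet curve that is both a magnetic trajectory of the contact magnetic field of some strength $q\neq0$ and a contact whirl curve. Let $T=\alpha'$, $\varepsilon_1=g(T,T)$ and $h=\frac12\mathcal L_\xi\Phi$. Then the torsion of $\alpha$ satisfies $$\tau=1-\varepsilon_1\,g(hT,T).$$
   Context: A contact Lorentzian (contact metric Lorentzian) $3$-manifold $(M,\eta,\xi,g,\Phi)$ is a smooth $3$-manifold with a contact form $\eta$, Reeb vector field $\xi$ ($\eta(\xi)=1$, $d\eta(\xi,\cdot)=0$), a Lorentzian metric $g$ with $g(\xi,\xi)=-1$, and a $(1,1)$-tensor $\Phi$ with $\Phi^2=-\mathrm{id}+\eta\otimes\xi$, $g(\Phi X,\Phi Y)=g(X,Y)+\eta(X)\eta(Y)$ and $d\eta(X,Y)=g(X,\Phi Y)$, where $d\eta(X,Y)=\tfrac12\bigl(X\eta(Y)-Y\eta(X)-\eta([X,Y])\bigr)$. In particular $\eta(X)=-g(X,\xi)$, $\eta\circ\Phi=0$, and, with $\nabla$ the Levi-Civita connection of $g$ and $h=\frac12\mathcal L_\xi\Phi$, one has $\nabla_X\xi=\Phi X-\Phi hX$. The vector product is $X\wedge Y=g(X,\Phi Y)\xi-\eta(Y)\Phi X+\eta(X)\Phi Y$. A (non-geodesic) Frenet curve is a unit-speed non-null curve $\alpha$, with $T=\alpha'$ and $g(T,T)=\varepsilon_1\in\{\pm1\}$,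 such that $\nabla_TT$ is non-null. It has an orthonormal Frenet frame $\{T,N,B\}$, with $g(N,N)=\varepsilon_2$, $g(B,B)=\varepsilon_3$, $\varepsilon_1\varepsilon_2=-\varepsilon_3$, oriented so that $T\wedge N=\varepsilon_3B$, $N\wedge B=\varepsilon_1T$, $B\wedge T=\varepsilon_2N$, and satisfying $$\nabla_TT=\varepsilon_2\kappa N,\quad \nabla_TN=-\varepsilon_1\kappa T-\varepsilon_3\tau B,\quad \nabla_TB=\varepsilon_2\tau N,$$ with curvature $\kappa>0$ and torsion $\tau$. It is a contact whirl curve if there is a constant $\varrho\neq0$ with $\eta(T)=\varrho\,\eta(N)$ along $\alpha$. For $q\neq0$, the contact magnetic field of strength $q$ is the closed $2$-form $F_{\xi,q}=-q\,d\eta$. Its Lorentz force, the $(1,1)$-tensor $\varphi$ with $g(\varphi(X),Y)=F_{\xi,q}(X,Y)$, is $\varphi=q\Phi$. A magnetic trajectory is a curve satisfying $\nabla_TT=\varphi(T)$, i.e. $\nabla_TT=q\,\Phi T$. *)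

(* Defs.v *)
From HB Require Import structures.
From mathcomp Require Import all_boot all_order all_algebra.
From mathcomp Require Import all_classical all_reals all_analysis.
From mathcomp Require Import ring.

Set Implicit Arguments.
Unset Strict Implicit.
Unset Printing Implicit Defensive.

Import Order.TTheory GRing.Theory Num.Theory.
Import numFieldNormedType.Exports.

Local Open Scope classical_set_scope.
Local Open Scope ring_scope.

(* Tangent vectors are represented in a chart by their row of components;
   linear maps act on the right, as for [jacobian], so that
   'D_u f x = u *m jacobian f x. *)

Section Smooth.
Variable R : realType.

Fixpoint Cn (n : nat) (V W : normedModType R) (A : set V) (f : V -> W) : Prop :=
  if n is m.+1 then
    (forall x, A x -> differentiable f x) /\ (forall v, Cn m A ('D_v f))
  else forall x, A x -> {for x, continuous f}.

Definition smooth_on (V W : normedModType R) (A : set V) (f : V -> W) : Prop :=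
  forall n, Cn n A f.

End Smooth.

Section Manifold.
Variable R : realType.

Record chart (M : topologicalType) := Chart {
  dom : set M;
  coord : M -> 'rV[R]_3;
  param : 'rV[R]_3 -> M;
  dom_open : open dom;
  img_open : open (coord @` dom);
  coordK : forall p, dom p -> param (coord p) = p;
  coord_continuous : forall p, dom p -> {for p, continuous coord};
  param_continuous : forall x, (coord @` dom) x -> {for x, continuous param} }.

Definition transition (M : topologicalType) (c d : chart M) :
  'rV[R]_3 -> 'rV[R]_3 := coord d \o param c.

Definition overlap (M : topologicalType) (c d : chart M) : set 'rV[R]_3 :=
  coord c @` (dom c `&` dom d).

Record manifold3 := Manifold3 {
  carrier :> topologicalType;
  carrier_hausdorff : hausdorff_space carrier;
  carrier_second_countable : @second_countable carrier;
  idx : Type;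
  atlas : idx -> chart carrier;
  atlas_cover : forall p : carrier, exists i, dom (atlas i) p;
  atlas_smooth : forall i j,
    smooth_on (overlap (atlas i) (atlas j)) (transition (atlas i) (atlas j)) }.

Definition img (M : manifold3) (i : idx M) : set 'rV[R]_3 :=
  coord (atlas i) @` dom (atlas i).

Definition trans (M : manifold3) (i j : idx M) := transition (atlas i) (atlas j).

Definition lap (M : manifold3) (i j : idx M) := overlap (atlas i) (atlas j).

(* A tensor field is the family of its smooth component functions in the charts
   of the atlas, subject to the transformation law of its type. *)

Record vfield (M : manifold3) := VField {
  vcomp :> idx M -> 'rV[R]_3 -> 'rV[R]_3;
  vcomp_smooth : forall i, smooth_on (img i) (vcomp i);
  vcomp_law : forall i j x, lap i j x ->
    vcomp j (trans i j x) = vcomp i x *m jacobian (trans i j) x }.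

Record oneform (M : manifold3) := OneForm {
  ocomp :> idx M -> 'rV[R]_3 -> 'cV[R]_3;
  ocomp_smooth : forall i, smooth_on (img i) (ocomp i);
  ocomp_law : forall i j x, lap i j x ->
    ocomp i x = jacobian (trans i j) x *m ocomp j (trans i j x) }.

Record tensor02 (M : manifold3) := Tensor02 {
  bcomp :> idx M -> 'rV[R]_3 -> 'M[R]_3;
  bcomp_smooth : forall i, smooth_on (img i) (bcomp i);
  bcomp_law : forall i j x, lap i j x ->
    bcomp i x = jacobian (trans i j) x *m bcomp j (trans i j x)
                  *m (jacobian (trans i j) x)^T }.

Record tensor11 (M : manifold3) := Tensor11 {
  ecomp :> idx M -> 'rV[R]_3 -> 'M[R]_3;
  ecomp_smooth : forall i, smooth_on (img i) (ecomp i);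
  ecomp_law : forall i j x, lap i j x ->
    ecomp i x *m jacobian (trans i j) x
    = jacobian (trans i j) x *m ecomp j (trans i j x) }.

End Manifold.

Section LocalCalculus.
Variable R : realType.
Implicit Types (X Y : 'rV[R]_3 -> 'rV[R]_3) (w : 'rV[R]_3 -> 'cV[R]_3)
  (G A : 'rV[R]_3 -> 'M[R]_3) (x u v : 'rV[R]_3).

Definition ev (w : 'cV[R]_3) (u : 'rV[R]_3) : R := (u *m w) 0 0.

Definition bil (G : 'M[R]_3) (u v : 'rV[R]_3) : R := (u *m G *m v^T) 0 0.

Definition bracket X Y : 'rV[R]_3 -> 'rV[R]_3 :=
  fun x => 'D_(X x) Y x - 'D_(Y x) X x.

Definition dform_fields w X Y : 'rV[R]_3 -> R := fun x =>
  2^-1 * ('D_(X x) (fun y => ev (w y) (Y y)) x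
          - 'D_(Y x) (fun y => ev (w y) (X y)) x
          - ev (w x) (bracket X Y x)).

(* The 1/2 above is the convention of contact metric geometry.  Since
   [dform_fields] is tensorial in X and Y (see [dform_fieldsE]), its value on
   vectors is obtained by extending them with constant components. *)
Definition dform w x u v : R := dform_fields w (cst u) (cst v) x.

Definition lie_fields X A Y : 'rV[R]_3 -> 'rV[R]_3 := fun x =>
  bracket X (fun y => Y y *m A y) x - bracket X Y x *m A x.

(* Tensorial in Y, see [lie_fieldsE]. *)
Definition lie11 X A x u : 'rV[R]_3 := lie_fields X A (cst u) x.

Definition dpart G x (a b c : 'I_3) : R :=
  'D_(delta_mx 0 a) (fun y => G y b c) x.

(* Christoffel symbol Gamma^k_{ab} of the Levi-Civita connection of G;
   see [christoffelC] and [christoffel_metric]. *)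
Definition christoffel G x (k a b : 'I_3) : R :=
  2^-1 * \sum_l invmx (G x) k l
                * (dpart G x a b l + dpart G x b a l - dpart G x l a b).

Definition christoffel_form G x u v : 'rV[R]_3 :=
  \row_k \sum_a \sum_b christoffel G x k a b * u 0 a * v 0 b.

Definition minkowski : 'M[R]_3 :=
  diag_mx (\row_(i < 3) if i == ord0 then -1 else 1).

Definition lorentzian (G : 'M[R]_3) : Prop :=
  G^T = G /\ exists2 P : 'M[R]_3, P \in unitmx & P *m G *m P^T = minkowski.

End LocalCalculus.

Section Facts.
Variable R : realType.

Lemma derivable_mulmx (V : normedModType R) m n p
    (P : V -> 'M[R]_(m, n)) (Q : V -> 'M[R]_(n, p)) (x v : V) :
  derivable P x v -> derivable Q x v ->
  derivable (fun y => P y *m Q y) x v /\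
  'D_v (fun y => P y *m Q y) x = 'D_v P x *m Q x + P x *m 'D_v Q x.
Proof.
move=> dP dQ.
have dPc i j := (derivable_mxP P x v).1 dP i j.
have dQc i j := (derivable_mxP Q x v).1 dQ i j.
have E i j : (fun y => (P y *m Q y) i j) =
    \sum_(k < n) ((fun y => P y i k) * (fun y => Q y k j)).
  by apply/funext => y; rewrite mxE fct_sumE.
have dM i j : derivable (fun y => (P y *m Q y) i j) x v.
  by rewrite E; apply: derivable_sum => k; exact: derivableM.
have dPQ : derivable (fun y => P y *m Q y) x v by apply/derivable_mxP.
split=> //; rewrite !derive_mx//; apply/matrixP => i j.
rewrite !mxE E derive_sum; last by move=> k; exact: derivableM.
rewrite -big_split; apply: eq_bigr => k _ /=.
rewrite deriveM// !mxE addrC; congr (_ + _).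
by rewrite /GRing.scale/= mulrC.
Qed.

Lemma dform_fieldsE (w : 'rV[R]_3 -> 'cV[R]_3) (X Y : 'rV[R]_3 -> 'rV[R]_3) x :
  differentiable w x -> differentiable X x -> differentiable Y x ->
  dform_fields w X Y x = dform w x (X x) (Y x).
Proof.
move=> dw dX dY.
have D Z u : differentiable Z x ->
    'D_u (fun y => ev (w y) (Z y)) x
    = ev (w x) ('D_u Z x) + ev ('D_u w x) (Z x).
  move=> dZ; rewrite /ev.
  have dw' : derivable w x u by exact: diff_derivable.
  have dZ' : derivable Z x u by exact: diff_derivable.
  have [d1 d2] := derivable_mulmx dZ' dw'.
  rewrite -[LHS](_ : ('D_u (fun y => Z y *m w y) x) 0 0 = _).
    by rewrite d2 mxE.
  by rewrite derive_mx// mxE.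
have dc u : differentiable (cst u : 'rV[R]_3 -> 'rV[R]_3) x.
  exact: differentiable_cst.
have d0 u v : 'D_v (cst u : 'rV[R]_3 -> 'rV[R]_3) x = 0 := derive_cst u x v.
rewrite /dform /dform_fields (D _ _ dX) (D _ _ dY) (D _ _ (dc (X x))).
rewrite (D _ _ (dc (Y x))) /bracket !d0 /ev.
move: ('D_(X x) Y x) ('D_(Y x) X x) ('D_(X x) w x) ('D_(Y x) w x) (w x) (X x)
  (Y x) => a b c d e f g.
rewrite !mulmxBl !mul0mx; congr (_ * _); rewrite !mxE.
ring.
Qed.

Lemma lie_fieldsE (X Y : 'rV[R]_3 -> 'rV[R]_3) (A : 'rV[R]_3 -> 'M[R]_3) x :
  differentiable X x -> differentiable A x -> differentiable Y x ->
  lie_fields X A Y x = lie11 X A x (Y x).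
Proof.
move=> dX dA dY; rewrite /lie11 /lie_fields /bracket.
have dY' : derivable Y x (X x) by exact: diff_derivable.
have dA' : derivable A x (X x) by exact: diff_derivable.
have dc := derivable_cst (Y x) x (X x).
rewrite (derivable_mulmx dY' dA').2 (derivable_mulmx dc dA').2 !derive_cst.
move: ('D_(X x) Y x) ('D_(Y x) X x) ('D_(X x) A x) ('D_(Y x *m A x) X x) (A x)
  (Y x) => a b c d e f.
by rewrite !mulmxBl !mul0mx; apply/matrixP => i j; rewrite !mxE; ring.
Qed.

Lemma dpartC (G : 'rV[R]_3 -> 'M[R]_3) x a b c :
  (\forall y \near x, (G y)^T = G y) -> dpart G x a b c = dpart G x a c b.
Proof.
move=> sG; apply: near_eq_derive; near=> y.
by rewrite -[in LHS](near sG y)// mxE.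
Unshelve. all: by end_near. Qed.

Lemma christoffelC (G : 'rV[R]_3 -> 'M[R]_3) x k a b :
  (\forall y \near x, (G y)^T = G y) ->
  christoffel G x k a b = christoffel G x k b a.
Proof.
move=> sG; congr (_ * _); apply: eq_bigr => l _; congr (_ * _).
by rewrite (dpartC l a b sG) [X in X - _]addrC.
Qed.

Lemma christoffel_metric (G : 'rV[R]_3 -> 'M[R]_3) x a b c :
  (\forall y \near x, (G y)^T = G y) -> G x \in unitmx ->
  dpart G x a b c = \sum_k christoffel G x k a b * G x k c
                    + \sum_k christoffel G x k a c * G x b k.
Proof.
move=> sG uG; have GC p q : G x p q = G x q p.
  by rewrite -[in LHS](nbhs_singleton sG) mxE.
pose F p q l := dpart G x p q l + dpart G x q p l - dpart G x l p q.
have L p q r : \sum_k christoffel G x k p q * G x k r = 2^-1 * F p q r.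
  transitivity (2^-1 * \sum_l (\sum_k G x r k * invmx (G x) k l) * F p q l).
    rewrite mulr_sumr; under [RHS]eq_bigr do rewrite mulr_suml mulr_sumr.
    rewrite exchange_big; apply: eq_bigr => k _.
    rewrite /christoffel (GC k r) -mulrA mulr_suml mulr_sumr.
    by apply: eq_bigr => l _; rewrite -/(F p q l); ring.
  congr (_ * _); have E l : \sum_k G x r k * invmx (G x) k l = (r == l)%:R.
    by have /matrixP/(_ r l) := mulmxV uG; rewrite !mxE.
  rewrite (bigD1 r)//= E eqxx mul1r big1 ?addr0// => l.
  by rewrite E eq_sym => /negPf ->; rewrite mul0r.
rewrite L (eq_bigr (fun k => christoffel G x k a c * G x k b)); last first.
  by move=> k _; rewrite GC.
rewrite L /F (dpartC a c b sG).
by field.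
Qed.

End Facts.

Section ContactLorentzian.
Variable R : realType.

Record contact_lorentzian (M : manifold3 R) := ContactLorentzian {
  eta : oneform M;
  xi : vfield M;
  metric : tensor02 M;
  Phi : tensor11 M;
  metric_lorentzian : forall i x, img i x -> lorentzian (metric i x);
  (* the form eta /\ d eta, up to a constant factor, is nowhere zero *)
  eta_contact : forall (i : idx M) x, img i x -> exists u v w,
    ev (eta i x) u * dform (eta i) x v w + ev (eta i x) v * dform (eta i) x w u
    + ev (eta i x) w * dform (eta i) x u v != 0;
  eta_xi : forall i x, img i x -> ev (eta i x) (xi i x) = 1;
  deta_xi : forall i x v, img i x -> dform (eta i) x (xi i x) v = 0;
  metric_xi : forall i x, img i x -> bil (metric i x) (xi i x) (xi i x) = -1;
  Phi2 : forall i x u, img i x ->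
    u *m Phi i x *m Phi i x = - u + ev (eta i x) u *: xi i x;
  metric_Phi : forall i x u v, img i x ->
    bil (metric i x) (u *m Phi i x) (v *m Phi i x)
    = bil (metric i x) u v + ev (eta i x) u * ev (eta i x) v;
  deta_metric : forall i x u v, img i x ->
    dform (eta i) x u v = bil (metric i x) u (v *m Phi i x) }.

Variables (M : manifold3 R) (S : contact_lorentzian M).

Definition hop (i : idx M) (x u : 'rV[R]_3) : 'rV[R]_3 :=
  2^-1 *: lie11 (xi S i) (Phi S i) x u.

Definition wedge (i : idx M) (x u v : 'rV[R]_3) : 'rV[R]_3 :=
  bil (metric S i x) u (v *m Phi S i x) *: xi S i x
  - ev (eta S i x) v *: (u *m Phi S i x)
  + ev (eta S i x) u *: (v *m Phi S i x).

Definition contact_magnetic_field (q : R) (i : idx M) (x u v : 'rV[R]_3) : R :=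
  - q * dform (eta S i) x u v.

Definition lorentz_force (F : idx M -> 'rV[R]_3 -> 'rV[R]_3 -> 'rV[R]_3 -> R)
    (phi : tensor11 M) : Prop :=
  forall i x u v, img i x -> bil (metric S i x) (u *m phi i x) v = F i x u v.

End ContactLorentzian.

Section Curves.
Variables (R : realType) (M : manifold3 R).

Definition times_in (I : set R) (f : R -> M) (i : idx M) : set R :=
  [set t | I t /\ dom (atlas i) (f t)].

(* Only the values of [cfun] on the open interval [cdom] are relevant. *)
Record curve := Curve {
  cdom : set R;
  cfun : R -> M;
  cdom_open : open cdom;
  cdom_interval : is_interval cdom;
  cdom_nonempty : cdom !=set0;
  cfun_continuous : forall t, cdom t -> {for t, continuous cfun};
  cfun_smooth : forall i, smooth_on (times_in cdom cfun i)
                            (coord (atlas i) \o cfun) }.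

Definition times (alpha : curve) := times_in (cdom alpha) (cfun alpha).

Definition pos (alpha : curve) (i : idx M) : R -> 'rV[R]_3 :=
  coord (atlas i) \o cfun alpha.

Definition vel (alpha : curve) (i : idx M) : R -> 'rV[R]_3 :=
  (pos alpha i)^`()%classic.

Record along (alpha : curve) := Along {
  acomp :> idx M -> R -> 'rV[R]_3;
  acomp_smooth : forall i,
    smooth_on (times alpha i) (acomp i);
  acomp_law : forall i j t, times alpha i t -> times alpha j t ->
    acomp j t = acomp i t *m jacobian (trans i j) (pos alpha i t) }.

Variable S : contact_lorentzian M.

Definition cov (alpha : curve) (V : idx M -> R -> 'rV[R]_3) (i : idx M) (t : R) :
    'rV[R]_3 :=
  (V i)^`()%classic t
  + christoffel_form (metric S i) (pos alpha i t) (vel alpha i t) (V i t).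

Definition inner (alpha : curve) (U V : idx M -> R -> 'rV[R]_3) i t : R :=
  bil (metric S i (pos alpha i t)) (U i t) (V i t).

Definition eta_along (alpha : curve) (V : idx M -> R -> 'rV[R]_3) i t : R :=
  ev (eta S i (pos alpha i t)) (V i t).

Definition wedge_along (alpha : curve) (U V : idx M -> R -> 'rV[R]_3) i t :=
  wedge S i (pos alpha i t) (U i t) (V i t).

(* The Frenet frame is (T, N, B) with T = vel alpha. *)
Record frenet (alpha : curve) (e1 e2 e3 : R) (N B : along alpha)
    (kappa tau : R -> R) : Prop := Frenet {
  frenet_e1 : e1 = 1 \/ e1 = -1;
  frenet_e2 : e2 = 1 \/ e2 = -1;
  frenet_e3 : e3 = 1 \/ e3 = -1;
  frenet_sign : e1 * e2 = - e3;
  frenet_TT : forall i t, times alpha i t ->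
    inner alpha (vel alpha) (vel alpha) i t = e1;
  frenet_nongeodesic : forall i t, times alpha i t ->
    inner alpha (cov alpha (vel alpha)) (cov alpha (vel alpha)) i t != 0;
  frenet_NN : forall i t, times alpha i t -> inner alpha N N i t = e2;
  frenet_BB : forall i t, times alpha i t -> inner alpha B B i t = e3;
  frenet_TN : forall i t, times alpha i t -> inner alpha (vel alpha) N i t = 0;
  frenet_TB : forall i t, times alpha i t -> inner alpha (vel alpha) B i t = 0;
  frenet_NB : forall i t, times alpha i t -> inner alpha N B i t = 0;
  frenet_TwN : forall i t, times alpha i t ->
    wedge_along alpha (vel alpha) N i t = e3 *: B i t;
  frenet_NwB : forall i t, times alpha i t ->
    wedge_along alpha N B i t = e1 *: vel alpha i t;
  frenet_BwT : forall i t, times alpha i t ->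
    wedge_along alpha B (vel alpha) i t = e2 *: N i t;
  frenet_kappa : forall t, cdom alpha t -> 0 < kappa t;
  frenet_dT : forall i t, times alpha i t ->
    cov alpha (vel alpha) i t = (e2 * kappa t) *: N i t;
  frenet_dN : forall i t, times alpha i t ->
    cov alpha N i t
    = - (e1 * kappa t) *: vel alpha i t - (e3 * tau t) *: B i t;
  frenet_dB : forall i t, times alpha i t ->
    cov alpha B i t = (e2 * tau t) *: N i t }.

Definition contact_whirl (alpha : curve) (N : along alpha) : Prop :=
  exists2 rho : R, rho != 0 & forall i t, times alpha i t ->
    eta_along alpha (vel alpha) i t = rho * eta_along alpha N i t.

Definition magnetic_trajectory (q : R) (alpha : curve) : Prop :=
  exists2 phi : tensor11 M,
    lorentz_force S (contact_magnetic_field S q) phi &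
    forall i t, times alpha i t ->
      cov alpha (vel alpha) i t = vel alpha i t *m phi i (pos alpha i t).

End Curves.

(* Main.v *)
Require Import Defs.
From mathcomp Require Import all_boot all_order all_algebra.
From mathcomp Require Import all_classical all_reals all_analysis.
From mathcomp Require Import ring lra.
Import Order.TTheory GRing.Theory Num.Theory.
Import numFieldNormedType.Exports.
Local Open Scope ring_scope.

Set Implicit Arguments.
Unset Strict Implicit.
Unset Printing Implicit Defensive.

Local Open Scope classical_set_scope.

(** The torsion is read off the derivative of the binormal.  Along a magnetic
    trajectory the normal is proportional to Phi T, on which eta vanishes; the
    whirl condition eta(T) = rho eta(N) then gives eta(T) = 0 ([legendre]).  Hence
    g(Phi T, Phi T) = g(T, T), comparing norms gives e2 = e1 and kappa = |q|, and the
    Frenet frame is (T, s Phi T, s e1 xi) with a constant sign s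
    ([magnetic_frame]).  The equation nabla_T B = e2 tau N becomes
    nabla_T xi = tau Phi T ([nabla_xi_tangent]), and pairing with Phi T leaves
    the computation of g(nabla_T xi, Phi T).

    That value is e1 - g(h T, T), from the identity nabla_u xi = Phi u - Phi (h u)
    of contact metric geometry ([nabla_xi_Phi]).  The identity splits into the skew
    part of nabla xi, which is - d eta since eta = - g(., xi), and the symmetric
    part, half the Lie derivative of g along xi.  The latter is related to h,
    half the Lie derivative of Phi, because d eta = g(., Phi .) is invariant under the Reeb flow
    ([lie_xi_deta]).  Invariance rests on d (d eta) = 0, that is, on the symmetry of
    second derivatives ([schwarz]), proved from the mean value theorem.

    Everything is computed in a chart with rows of components; the derivative of a
    vector with constant components along u is then its Christoffel term, and
    [derive_metric] and [christoffel_formC] say that the connection is metric and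
    torsion-free. *)

(** * Symmetry of second directional derivatives *)

Section Schwarz.
Variables (R : realType) (V : normedModType R).
Implicit Types (f : V -> R) (x u v : V).

Lemma is_derive_translate f x u v df :
  is_derive (x + v) u f df -> is_derive x u (fun y => f (y + v)) df.
Proof.
have E : (fun h : R => h^-1 *: (((fun y => f (y + v)) \o shift x) (h *: u) - f (x + v)))
  = (fun h : R => h^-1 *: ((f \o shift (x + v)) (h *: u) - f (x + v))).
  by apply/funext => h /=; rewrite addrA.
by case=> df_ex df_val; apply: DeriveDef; rewrite /derivable /derive E.
Qed.

Lemma is_derive_line f x u (s : R) df :
  is_derive (x + s *: u) u f df -> is_derive s 1 (fun r : R => f (x + r *: u)) df.
Proof.
have E : (fun h : R => h^-1 *: (((fun r : R => f (x + r *: u)) \o shift s) (h *: 1)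
    - f (x + s *: u)))
  = (fun h : R => h^-1 *: ((f \o shift (x + s *: u)) (h *: u) - f (x + s *: u))).
  by apply/funext => h /=; rewrite [h *: 1]mulr1 scalerDl addrCA.
by case=> df_ex df_val; apply: DeriveDef; rewrite /derivable /derive E.
Qed.

Lemma MVT_line f df x u (h : R) : 0 < h ->
  (forall s, 0 <= s <= h -> is_derive (x + s *: u) u f (df (x + s *: u))) ->
  exists2 c, 0 < c < h & f (x + h *: u) - f x = h * df (x + c *: u).
Proof.
move=> h0 fdf.
have I s : 0 <= s <= h ->
    is_derive s 1 (fun r : R => f (x + r *: u)) (df (x + s *: u)).
  by move=> /fdf; exact: is_derive_line.
have [||c] :=
  @MVT R (fun r => f (x + r *: u)) (fun r => df (x + r *: u)) 0 h h0.
- by move=> s; rewrite in_itv/= => /andP[a b]; apply: I; rewrite !ltW.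
- apply: derivable_within_continuous => s; rewrite in_itv/= => sh.
  by have [] := I _ sh.
rewrite in_itv/= => ch; rewrite scale0r addr0 subr0 mulrC => ->.
by exists c.
Qed.

(** The second difference over the parallelogram with sides [h *: u] and [h *: v]
    is the increment of [y |-> f (y + h *: v) - f y] along [u]; the mean value
    theorem applies to that increment, then to the first derivative along [v]. *)
Lemma second_difference f fu fuv x u v (h : R) : 0 < h ->
  (forall s t, 0 <= s <= h -> 0 <= t <= h ->
     is_derive (x + s *: u + t *: v) u f (fu (x + s *: u + t *: v)) /\
     is_derive (x + s *: u + t *: v) v fu (fuv (x + s *: u + t *: v))) ->
  exists c d, [/\ 0 < c < h, 0 < d < h &
    f (x + h *: u + h *: v) - f (x + h *: u) - (f (x + h *: v) - f x)
    = h * (h * fuv (x + c *: u + d *: v))].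
Proof.
move=> h0 df; have hh : 0 <= h <= h by rewrite lexx ltW.
have zh : (0 : R) <= 0 <= h by rewrite lexx ltW.
have dg s : 0 <= s <= h -> is_derive (x + s *: u) u (fun y => f (y + h *: v) - f y)
    (fu (x + s *: u + h *: v) - fu (x + s *: u)).
  move=> sh; apply: is_deriveB; first exact: is_derive_translate (df _ _ sh hh).1.
  by have := (df _ _ sh zh).1; rewrite scale0r addr0.
have [c ch E] := MVT_line (df := fun y => fu (y + h *: v) - fu y) h0 dg.
have ch' : 0 <= c <= h by have /andP[a b] := ch; rewrite !ltW.
have [d dh E'] := MVT_line h0 (fun t th => (df _ t ch' th).2).
exists c, d; split=> //; rewrite -E'; exact: E.
Qed.

(** The second difference of [f] does not depend on the order of the two sides,
    so over arbitrarily small parallelograms each mixed derivative takes a value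
    that the other one takes nearby; continuity at [x] makes them equal.  The
    derivatives are passed as functions because the entries of a matrix-valued
    derivative agree with the derivatives of the entries on [A] only. *)
Lemma schwarz f fu fv fuv fvu (A : set V) x u v : open A -> A x ->
  (forall y, A y -> is_derive y u f (fu y)) ->
  (forall y, A y -> is_derive y v f (fv y)) ->
  (forall y, A y -> is_derive y v fu (fuv y)) ->
  (forall y, A y -> is_derive y u fv (fvu y)) ->
  {for x, continuous fuv} -> {for x, continuous fvu} -> fuv x = fvu x.
Proof.
move=> oA Ax dfu dfv dfuv dfvu c1 c2; apply/eqP; rewrite -subr_eq0 -normr_le0.
apply/ler_addgt0Pl => e e0; rewrite addr0.
have : \forall y \near x, [/\ A y, `|fuv x - fuv y| < e / 2
     & `|fvu x - fvu y| < e / 2].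
  have e2 : 0 < e / 2 by rewrite divr_gt0.
  near=> y; split; near: y.
  - exact: open_nbhs_nbhs.
  - by move/cvgrPdist_lt : c1; exact.
  - by move/cvgrPdist_lt : c2; exact.
move=> /nbhs_normP[r /= r0 Ar].
pose k := `|u| + `|v| + 1; have k0 : 0 < k by rewrite ltr_pwDr ?addr_ge0.
(* small enough for the parallelogram of sides h u and h v to stay in the ball *)
pose h := r / k; have h0 : 0 < h by rewrite divr_gt0.
have near_x s t : 0 <= s <= h -> 0 <= t <= h ->
    ball_ Num.Def.normr x r (x + s *: u + t *: v).
  move=> /andP[s0 sh] /andP[t0 th] /=.
  rewrite -addrA opprD addNKr normrN.
  have H : h * k = r by rewrite /h divfK// gt_eqF.
  rewrite (le_lt_trans (ler_normD _ _))// !normrZ !ger0_norm// -H /k !mulrDr mulr1.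
  by rewrite ltr_pwDr// lerD// ler_wpM2r.
have [|c [d [ch dh E1]]] := @second_difference f fu fuv x u v h h0.
  move=> s t sh th; have [Ay _ _] := Ar _ (near_x _ _ sh th).
  by split; [exact: dfu|exact: dfuv].
have [|c' [d' [ch' dh' E2]]] := @second_difference f fv fvu x v u h h0.
  move=> s t sh th; rewrite addrAC; have [Ay _ _] := Ar _ (near_x _ _ th sh).
  by split; [exact: dfv|exact: dfvu].
have W a : 0 < a < h -> 0 <= a <= h by move=> /andP[? ?]; rewrite !ltW.
have [_ B1 _] := Ar _ (near_x _ _ (W _ ch) (W _ dh)).
have [_ _ B2] := Ar _ (near_x _ _ (W _ dh') (W _ ch')).
have E : fuv (x + c *: u + d *: v) = fvu (x + d' *: u + c' *: v).
  apply/(mulfI (lt0r_neq0 h0))/(mulfI (lt0r_neq0 h0)).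
  rewrite -E1 [x + d' *: u + _]addrAC -E2 [x + h *: v + _]addrAC.
  by ring.
rewrite -E in B2; move: B1 B2.
move: (fuv (_ + _)) (fuv x) (fvu x) => z a b.
rewrite [`|b - z|]distrC => B1 B2.
by rewrite (le_trans (ler_distD z _ _))// [leRHS]splitr lerD// ltW.
Unshelve. all: by end_near. Qed.

End Schwarz.

(** * Calculus of smooth maps and of matrix-valued maps *)

Section SmoothMaps.
Variables (R : realType) (V W : normedModType R) (A : set V).

Lemma smooth_differentiable (f : V -> W) x :
  smooth_on A f -> A x -> differentiable f x.
Proof. by move=> /(_ 1%N)[df _]; exact: df. Qed.

Lemma smooth_derive (f : V -> W) v : smooth_on A f -> smooth_on A ('D_v f).
Proof. by move=> sf n; have [_] := sf n.+1; exact. Qed.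

Lemma smooth_derivable (f : V -> W) x v :
  smooth_on A f -> A x -> derivable f x v.
Proof. by move=> sf Ax; apply: diff_derivable; exact: smooth_differentiable Ax. Qed.

End SmoothMaps.

Section MatrixCalculus.
Variables (R : realType) (V : normedModType R).

Lemma is_derive_coord m n (f : V -> 'M[R]_(m, n)) x v i j :
  derivable f x v -> is_derive x v (fun y => f y i j) ('D_v f x i j).
Proof.
move=> df; apply: DeriveDef; first by move/derivable_mxP : df; exact.
by rewrite derive_mx// mxE.
Qed.

Lemma schwarz_mx m n (f : V -> 'M[R]_(m, n)) (A : set V) x u v :
  open A -> smooth_on A f -> A x -> 'D_v ('D_u f) x = 'D_u ('D_v f) x.
Proof.
move=> oA sf Ax; apply/matrixP => i j.
have d w y : A y -> is_derive y w (fun z => f z i j) ('D_w f y i j).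
  by move=> Ay; apply: is_derive_coord; exact: smooth_derivable Ay.
have dd w w' y : A y -> is_derive y w' (fun z => 'D_w f z i j) ('D_w' ('D_w f) y i j).
  move=> Ay; apply: is_derive_coord.
  exact: smooth_derivable (smooth_derive _ sf) Ay.
have c w w' : {for x, continuous (fun z => 'D_w' ('D_w f) z i j)}.
  apply: (@continuous_comp _ _ _ ('D_w' ('D_w f)) (fun M : 'M[R]_(m, n) => M i j)).
    exact: (smooth_derive w' (smooth_derive w sf) 0%N x Ax).
  exact: coord_continuous.
exact: (schwarz oA Ax (d u) (d v) (dd u v) (dd v u)).
Qed.

Lemma derivable_trmx m n (f : V -> 'M[R]_(m, n)) x v : derivable f x v ->
  derivable (fun y => (f y)^T) x v /\ 'D_v (fun y => (f y)^T) x = ('D_v f x)^T.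
Proof.
move=> df.
have E i j : (fun y => (f y)^T i j) = (fun y => f y j i).
  by apply/funext => y; rewrite mxE.
have dT : derivable (fun y => (f y)^T) x v.
  by apply/derivable_mxP => i j; rewrite E; exact: (derivable_mxP f x v).1 df j i.
by split=> //; rewrite !derive_mx//; apply/matrixP => i j; rewrite !mxE E.
Qed.

End MatrixCalculus.

Section Bilinear.
Variable R : realType.
Implicit Types (G : 'M[R]_3) (u v : 'rV[R]_3) (w : 'cV[R]_3) (k : R).

Lemma bil0l G v : bil G 0 v = 0.
Proof. by rewrite /bil !mul0mx mxE. Qed.

Lemma bil0r G u : bil G u 0 = 0.
Proof. by rewrite /bil trmx0 mulmx0 mxE. Qed.

Lemma bilDl G u1 u2 v : bil G (u1 + u2) v = bil G u1 v + bil G u2 v.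
Proof. by rewrite /bil !mulmxDl mxE. Qed.

Lemma bilDr G u v1 v2 : bil G u (v1 + v2) = bil G u v1 + bil G u v2.
Proof. by rewrite /bil linearD/= mulmxDr mxE. Qed.

Lemma bilZl G k u v : bil G (k *: u) v = k * bil G u v.
Proof. by rewrite /bil -!scalemxAl mxE. Qed.

Lemma bilZr G k u v : bil G u (k *: v) = k * bil G u v.
Proof. by rewrite /bil linearZ/= -scalemxAr mxE. Qed.

Lemma bilNr G u v : bil G u (- v) = - bil G u v.
Proof. by rewrite -scaleN1r bilZr mulN1r. Qed.

Lemma bilC G u v : G^T = G -> bil G u v = bil G v u.
Proof.
move=> sG; rewrite /bil -[in LHS](trmxK (u *m G *m v^T)) mxE.
by rewrite !trmx_mul trmxK sG mulmxA.
Qed.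

Lemma bil_trmx G F u v : bil (G *m F^T) u v = bil G u (v *m F).
Proof. by rewrite /bil trmx_mul !mulmxA. Qed.

Lemma lorentzian_unitmx G : lorentzian G -> G \in unitmx.
Proof.
move=> [_ [P _ PGP]]; have : Defs.minkowski R \in unitmx.
  rewrite unitmxE det_diag unitfE; apply/prodf_neq0 => i _.
  by rewrite mxE; case: ifP => _; rewrite ?oppr_eq0 oner_neq0.
by rewrite -PGP !unitmx_mul => /andP[/andP[_ ->]].
Qed.

(** A Lorentzian matrix is invertible because it is congruent to the Minkowski
    matrix, so pairing with every vector determines a vector. *)
Lemma bil_nondegenerate G u v : lorentzian G ->
  (forall z, bil G u z = bil G v z) -> u = v.
Proof.
move=> /lorentzian_unitmx uG E.
suff : u *m G = v *m G by move/(can_inj (mulmxK uG)).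
apply/rowP => j; have := E (delta_mx 0 j).
by rewrite /bil trmx_delta -!colE !mxE.
Qed.

Lemma ev0 w : ev w 0 = 0.
Proof. by rewrite /ev mul0mx mxE. Qed.

Lemma evZ w k u : ev w (k *: u) = k * ev w u.
Proof. by rewrite /ev -scalemxAl mxE. Qed.

End Bilinear.

Section DeriveBilinear.
Variables (R : realType) (V : normedModType R).

Lemma is_derive_bil (G : V -> 'M[R]_3) (X Y : V -> 'rV[R]_3) x z :
  derivable G x z -> derivable X x z -> derivable Y x z ->
  is_derive x z (fun y => bil (G y) (X y) (Y y))
    (bil ('D_z G x) (X x) (Y x) + bil (G x) ('D_z X x) (Y x)
     + bil (G x) (X x) ('D_z Y x)).
Proof.
move=> dG dX dY.
have [dXG EXG] := derivable_mulmx dX dG.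
have [dYT EYT] := derivable_trmx dY.
have [d E] := derivable_mulmx dXG dYT.
have [d0 E0] := is_derive_coord 0 0 d.
apply: DeriveDef => //; rewrite [LHS]E0 E EXG EYT mulmxDl /bil.
by rewrite mxE [X in X + _]mxE [X in X + _]addrC.
Qed.

Lemma is_derive_ev (w : V -> 'cV[R]_3) u x z : derivable w x z ->
  is_derive x z (fun y => ev (w y) u) (ev ('D_z w x) u).
Proof.
move=> dw; have [d E] := derivable_mulmx (derivable_cst u x z) dw.
have [d0 E0] := is_derive_coord 0 0 d.
by apply: DeriveDef => //; rewrite [LHS]E0 E derive_cst mul0mx add0r.
Qed.

End DeriveBilinear.

(** * The alternation of a symmetric second derivative *)

Section Alternation.
Variables (R : realType) (T : Type) (D O : T -> T -> T -> R).
Hypothesis OE : forall z a b, O z a b = 2^-1 * (D z a b - D z b a).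

Lemma alternation_skew z a b : O z a b = - O z b a.
Proof. by rewrite !OE -mulrN opprB. Qed.

(** The identity behind d (d eta) = 0: with [D z a b] the second derivative of
    eta along [z] and [a], evaluated on [b], the form [O z] is the derivative of
    d eta along [z]. *)
Lemma alternation_closed : (forall a b c, D a b c = D b a c) ->
  forall a b c, O a b c + O b c a + O c a b = 0.
Proof. by move=> DC a b c; rewrite !OE (DC b a) (DC c a) (DC c b); ring. Qed.

End Alternation.

(** * Metric compatibility of the Levi-Civita connection *)

Section LeviCivita.
Variable R : realType.
Implicit Types (G : 'rV[R]_3 -> 'M[R]_3) (x u v z : 'rV[R]_3).

Lemma derive_dpart G x u b c : differentiable G x ->
  'D_u G x b c = \sum_a u 0 a * dpart G x a b c.
Proof.
move=> dG; rewrite deriveE// [in LHS](row_sum_delta u) linear_sum summxE.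
apply: eq_bigr => a _; rewrite linearZ mxE -deriveE//; congr (_ * _).
by have [_ <-] := is_derive_coord b c (@diff_derivable _ _ _ _ _ (delta_mx 0 a) dG).
Qed.

(** The connection matrix in the direction [u], for row vectors multiplied on the
    left: it turns compatibility with the metric into the matrix identity of
    [derive_metric_mx]. *)
Definition connection_mx G x u : 'M[R]_3 :=
  \matrix_(b, k) \sum_a christoffel G x k a b * u 0 a.

Lemma christoffel_form_mx G x u v :
  christoffel_form G x u v = v *m connection_mx G x u.
Proof.
apply/rowP => k; rewrite !mxE exchange_big; apply: eq_bigr => b _.
by rewrite mxE mulr_sumr; apply: eq_bigr => a _; rewrite mulrC.
Qed.

Lemma christoffel_formC G x u v : (\forall y \near x, (G y)^T = G y) ->
  christoffel_form G x u v = christoffel_form G x v u.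
Proof.
move=> sG; apply/rowP => k; rewrite !mxE exchange_big.
apply: eq_bigr => b _; apply: eq_bigr => a _.
by rewrite (christoffelC k a b sG); ring.
Qed.

Lemma derive_metric_mx G x u : (\forall y \near x, (G y)^T = G y) ->
  G x \in unitmx -> differentiable G x ->
  'D_u G x = connection_mx G x u *m G x + G x *m (connection_mx G x u)^T.
Proof.
move=> sG uG dG; apply/matrixP => b c; rewrite derive_dpart// !mxE.
under eq_bigr do rewrite (christoffel_metric _ _ _ sG uG) mulrDr !mulr_sumr.
rewrite big_split; congr (_ + _); rewrite exchange_big; apply: eq_bigr => k _.
  by rewrite mxE mulr_suml; apply: eq_bigr => a _; rewrite mulrA [u 0 a * _]mulrC.
by rewrite !mxE mulr_sumr; apply: eq_bigr => a _ /=; ring.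
Qed.

(** Since [v] and [z] have constant components, their covariant derivatives
    along [u] are just the Christoffel terms. *)
Lemma derive_metric G x u v z : (\forall y \near x, (G y)^T = G y) ->
  G x \in unitmx -> differentiable G x ->
  bil ('D_u G x) v z = bil (G x) (christoffel_form G x u v) z
                       + bil (G x) v (christoffel_form G x u z).
Proof.
move=> sG uG dG; rewrite derive_metric_mx// !christoffel_form_mx -bil_trmx.
by rewrite /bil mulmxDr mulmxDl mxE !mulmxA.
Qed.

End LeviCivita.

(** * Pointwise identities of a contact Lorentzian structure *)

Section ContactAlgebra.
Variables (R : realType) (M : manifold3 R) (S : contact_lorentzian M) (i : idx M).
Variable x : 'rV[R]_3.
Hypothesis ix : img i x.
Implicit Types u v z : 'rV[R]_3.

Local Notation G := (metric S i).
Local Notation w := (eta S i).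
Local Notation X := (xi S i).
Local Notation F := (Phi S i).

Lemma near_img : \forall y \near x, img i y.
Proof. by apply: open_nbhs_nbhs; split=> //; exact: img_open. Qed.

Lemma metric_near_sym : \forall y \near x, (G y)^T = G y.
Proof. by apply: filterS near_img => y /(metric_lorentzian S)[]. Qed.

Let sG : (G x)^T = G x := nbhs_singleton metric_near_sym.
Let lG : lorentzian (G x) := metric_lorentzian S ix.
Let dw : differentiable w x := smooth_differentiable (ocomp_smooth (eta S) i) ix.

Lemma dformE u v : dform w x u v = 2^-1 * (ev ('D_u w x) v - ev ('D_v w x) u).
Proof.
have dwz z : derivable w x z := diff_derivable dw.
rewrite /dform /dform_fields /bracket !derive_cst subrr ev0 subr0.
have [_ E1] := is_derive_ev v (dwz u); have [_ E2] := is_derive_ev u (dwz v).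
by rewrite -E1 -E2.
Qed.

Lemma dform_antisym u v : dform w x u v = - dform w x v u.
Proof. by rewrite !dformE -mulrN opprB. Qed.

Lemma Phi_skew u v : bil (G x) (u *m F x) v = - bil (G x) u (v *m F x).
Proof. by rewrite bilC// -!deta_metric// dform_antisym. Qed.

(** By skewness, g(Phi xi, z) = - d eta(xi, z), which vanishes for the Reeb
    field. *)
Lemma Phi_xi : X x *m F x = 0.
Proof.
apply: (bil_nondegenerate lG) => z; rewrite Phi_skew -deta_metric// deta_xi//.
by rewrite oppr0 bil0l.
Qed.

(** This is the compatibility of the metric with Phi on the pair (u, xi), where
    the left-hand side vanishes because Phi xi = 0. *)
Lemma eta_metric u : ev (w x) u = - bil (G x) u (X x).
Proof.
have := metric_Phi S u (X x) ix.
rewrite Phi_xi eta_xi// mulr1 bil0r => /eqP.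
by rewrite eq_sym addr_eq0 -eqr_oppLR => /eqP <-.
Qed.

Lemma eta_Phi u : ev (w x) (u *m F x) = 0.
Proof. by rewrite eta_metric Phi_skew Phi_xi bil0r !oppr0. Qed.

End ContactAlgebra.

(** * The covariant derivative of the Reeb field *)

(** The linear algebra that recovers a bilinear form from its symmetric and
    skew parts, here for (u, y) |-> g(nabla_u xi, y) with y = Phi v.  [DX], [Dy]
    and [Du] are the derivatives of the metric along xi, y and u; [cuX], [cyX]
    and [cuy] are metric products with Christoffel terms; [f] is
    g(Phi u, y); [gu] and [gy] come from the derivatives of xi along u and y;
    [gd] and [gF] are the remaining terms of the Lie derivative of Phi.  The fourth equation is the skew part,
    the fifth (invariance of d eta) the symmetric part. *)
Lemma koszul_arith (R : realType) (DX Dy Du cuX cyX cuy f gu gy gd gF : R) :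
  DX = cuX + cyX -> Dy = cyX + cuy -> Du = cuX + cuy ->
  f = - (2^-1 * (- (Du + gu) - - (Dy + gy))) ->
  DX + gd + gu + gF = 0 ->
  gu + cuX = f - 2^-1 * (gd - gy + gF).
Proof. lra. Qed.

Section CovariantReeb.
Variables (R : realType) (M : manifold3 R) (S : contact_lorentzian M) (i : idx M).
Variable x : 'rV[R]_3.
Hypothesis ix : img i x.
Implicit Types u v z : 'rV[R]_3.

Local Notation G := (metric S i).
Local Notation w := (eta S i).
Local Notation X := (xi S i).
Local Notation F := (Phi S i).

Let sG : (G x)^T = G x := nbhs_singleton (metric_near_sym S ix).
Let lG : lorentzian (G x) := metric_lorentzian S ix.
Let dG : differentiable G x := smooth_differentiable (bcomp_smooth (metric S) i) ix.
Let dw : differentiable w x := smooth_differentiable (ocomp_smooth (eta S) i) ix.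
Let dX : differentiable X x := smooth_differentiable (vcomp_smooth (xi S) i) ix.
Let dF : differentiable F x := smooth_differentiable (ecomp_smooth (Phi S) i) ix.

(** In components, this is the vanishing of the Lie derivative of d eta along
    xi.  As in Cartan's formula, it combines two facts: d (d eta) = 0, by the
    symmetry of second derivatives, and d eta(xi, .) = 0, which can be
    differentiated because it holds in a neighbourhood. *)
Lemma lie_xi_deta u v :
  'D_(X x) (fun y => dform w y u v) x + dform w x ('D_u X x) v
  + dform w x u ('D_v X x) = 0.
Proof.
(* the matrix of d eta, so that its derivatives reduce to those of a matrix *)
pose Om y := G y *m (F y)^T.
have OmE y a b : img i y -> bil (Om y) a b = dform w y a b.
  by move=> iy; rewrite bil_trmx deta_metric.
have dOm z : derivable Om x z.
  have [dFT _] := derivable_trmx (@diff_derivable _ _ _ _ _ z dF).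
  by have [] := derivable_mulmx (@diff_derivable _ _ _ _ _ z dG) dFT.
have DOm z a b : 'D_z (fun y => dform w y a b) x = bil ('D_z Om x) a b.
  have [_] := is_derive_bil (dOm z) (derivable_cst a x z) (derivable_cst b x z).
  rewrite !derive_cst bil0l bil0r !addr0 => <-.
  by apply: near_eq_derive; apply: filterS (near_img ix) => y iy; rewrite OmE.
have Dw z a b : is_derive x z (fun y => ev ('D_a w y) b) (ev ('D_z ('D_a w) x) b).
  apply: is_derive_ev.
  exact: smooth_derivable (smooth_derive a (ocomp_smooth (eta S) i)) ix.
have DOmE z a b : bil ('D_z Om x) a b
    = 2^-1 * (ev ('D_z ('D_a w) x) b - ev ('D_z ('D_b w) x) a).
  have Dg : is_derive x z (fun y => 2^-1 * (ev ('D_a w y) b - ev ('D_b w y) a))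
      (2^-1 * (ev ('D_z ('D_a w) x) b - ev ('D_z ('D_b w) x) a)).
    exact: is_deriveZ (is_deriveB (Dw z a b) (Dw z b a)).
  rewrite -DOm; have [_ <-] := Dg.
  by apply: near_eq_derive; apply: filterS (near_img ix) => y iy; rewrite (dformE S iy).
have DOmX z b : bil ('D_z Om x) (X x) b = - dform w x ('D_z X x) b.
  apply/eqP; rewrite -addr_eq0 -OmE//.
  have [_] := is_derive_bil (dOm z) (diff_derivable dX) (derivable_cst b x z).
  rewrite derive_cst bil0r addr0 => <-.
  rewrite -(derive_cst (0 : R) x z); apply/eqP.
  apply: near_eq_derive; apply: filterS (near_img ix) => y iy.
  by rewrite OmE// deta_xi.
have sw a b : 'D_a ('D_b w) x = 'D_b ('D_a w) x.
  exact: schwarz_mx (@img_open _ _ (atlas i)) (ocomp_smooth (eta S) i) ix.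
have e_sw a b c : ev ('D_a ('D_b w) x) c = ev ('D_b ('D_a w) x) c by rewrite sw.
have cyc := alternation_closed DOmE e_sw (X x) u v.
have Eu : bil ('D_u Om x) v (X x) = dform w x ('D_u X x) v.
  exact: etrans (alternation_skew DOmE u v (X x)) (canLR (@opprK R) (DOmX u v)).
rewrite [dform w x u _](dform_antisym S ix) DOm.
by apply: etrans cyc; congr (_ + _ + _); exact: esym.
Qed.

Definition nabla_xi u : 'rV[R]_3 := 'D_u X x + christoffel_form G x u (X x).

(** The form in which nabla_u xi = Phi u - Phi (h u) is used.  The skew part of
    nabla xi is - d eta because eta is dual to - xi.  Its symmetric part is half
    the Lie derivative L g along xi; as d eta = g(., Phi .) is invariant, Leibniz'
    rule gives (L g)(u, Phi v) = - g(u, (L Phi) v) = - 2 g(u, h v). *)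
Lemma nabla_xi_Phi u v : bil (G x) (nabla_xi u) (v *m F x)
  = bil (G x) (u *m F x) (v *m F x) - bil (G x) u (hop S i x v).
Proof.
have uG : G x \in unitmx by exact: lorentzian_unitmx.
have Gdiff z a b := derive_metric z a b (metric_near_sym S ix) uG dG.
have GC a b : bil (G x) a b = bil (G x) b a := bilC a b sG.
have chC a b : christoffel_form G x a b = christoffel_form G x b a.
  exact: christoffel_formC (metric_near_sym S ix).
pose y := v *m F x.
have dGz z := @diff_derivable _ _ _ _ _ z dG.
have dXz z := @diff_derivable _ _ _ _ _ z dX.
have Dw z a : ev ('D_z w x) a = - (bil ('D_z G x) (X x) a + bil (G x) ('D_z X x) a).
  have [_ <-] := is_derive_ev a (diff_derivable (v := z) dw).
  have [_ ] := is_deriveN (is_derive_bil (dGz z) (dXz z) (derivable_cst a x z)).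
  rewrite derive_cst bil0r addr0 => <-.
  apply: near_eq_derive; apply: filterS (near_img ix) => p ip /=.
  by rewrite (eta_metric S ip) bilC//; have [] := metric_lorentzian S ip.
have dvF : derivable (fun p => v *m F p) x (X x) /\
    'D_(X x) (fun p => v *m F p) x = v *m 'D_(X x) F x.
  have [d ->] := derivable_mulmx (derivable_cst v x (X x)) (diff_derivable dF).
  by rewrite derive_cst mul0mx add0r.
have Ddeta : 'D_(X x) (fun p => dform w p u v) x
    = bil ('D_(X x) G x) u y + bil (G x) u (v *m 'D_(X x) F x).
  have [_] := is_derive_bil (dGz (X x)) (derivable_cst u x (X x)) dvF.1.
  rewrite dvF.2 derive_cst bil0l addr0 => <-.
  apply: near_eq_derive; apply: filterS (near_img ix) => p ip.
  by rewrite deta_metric.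
have hopE : hop S i x v
    = 2^-1 *: (v *m 'D_(X x) F x - 'D_y X x + 'D_v X x *m F x).
  by rewrite /hop /lie11 /lie_fields /bracket dvF.2 !derive_cst sub0r mulNmx
    opprK.
have := lie_xi_deta u v; rewrite Ddeta !deta_metric//.
have := Phi_skew S ix u y; rewrite -(deta_metric S) // (dformE S ix) !Dw.
have := Gdiff u (X x) y; have := Gdiff y (X x) u; have := Gdiff (X x) u y.
rewrite hopE bilZr !bilDr bilNr /nabla_xi bilDl -/y.
rewrite (chC (X x) u) (chC (X x) y) (chC y u).
rewrite (GC u (christoffel_form _ _ y _)) (GC (X x)) (GC u ('D_y X x)).
exact: koszul_arith.
Qed.

End CovariantReeb.

(** * Magnetic whirl curves *)

Section MagneticWhirl.
Variables (R : realType) (M : manifold3 R) (S : contact_lorentzian M).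
Variables (alpha : curve M) (e1 e2 e3 : R) (N B : along alpha).
Variables (kappa tau : R -> R) (q : R).
Hypothesis hfrenet : frenet S e1 e2 e3 N B kappa tau.
Hypothesis hq : q != 0.
Hypothesis hmagnetic : magnetic_trajectory S q alpha.
Hypothesis hwhirl : contact_whirl S N.

Local Notation T := (vel alpha).
Local Notation p i t := (pos alpha i t).

Lemma pos_img i t : times alpha i t -> img i (p i t).
Proof. by move=> [_ d]; exists (cfun alpha t). Qed.

Lemma near_times i t : times alpha i t -> \forall s \near t, times alpha i s.
Proof.
move=> [ct dt]; near=> s; split; near: s.
  by apply: open_nbhs_nbhs; split=> //; exact: cdom_open.
apply: (cfun_continuous ct); apply: open_nbhs_nbhs; split=> //; exact: dom_open.
Unshelve. all: by end_near. Qed.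

Lemma lorentz_forceE (phi : tensor11 M) i (x u : 'rV[R]_3) :
  lorentz_force S (contact_magnetic_field S q) phi -> img i x ->
  u *m phi i x = q *: (u *m Phi S i x).
Proof.
move=> hphi ix; apply: (bil_nondegenerate (metric_lorentzian S ix)) => z.
rewrite hphi// /contact_magnetic_field deta_metric// bilZl (Phi_skew S ix).
by rewrite mulNr mulrN.
Qed.

Lemma magnetic_normal i t : times alpha i t ->
  (e2 * kappa t) *: N i t = q *: (T i t *m Phi S i (p i t)).
Proof.
move=> it; have [phi hphi trajectory] := hmagnetic.
rewrite -(frenet_dT hfrenet it) trajectory// (lorentz_forceE _ hphi)//.
exact: pos_img.
Qed.

Let e2_sqr : e2 * e2 = 1.
Proof. by have [] := frenet_e2 hfrenet => ->; rewrite ?mulrNN mulr1. Qed.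

Let e1_sqr : e1 * e1 = 1.
Proof. by have [] := frenet_e1 hfrenet => ->; rewrite ?mulrNN mulr1. Qed.

Let e2_neq0 : e2 != 0.
Proof. by apply: contra_eq_neq e2_sqr => ->; rewrite mul0r eq_sym oner_eq0. Qed.

(** The normal is proportional to Phi T, on which eta vanishes, so the whirl
    condition forces eta(T) to vanish as well. *)
Lemma legendre i t : times alpha i t -> ev (eta S i (p i t)) (T i t) = 0.
Proof.
move=> it; have [rho _ whirl] := hwhirl.
have := whirl i t it; rewrite /eta_along => ->.
have k0 : e2 * kappa t != 0.
  by rewrite mulf_neq0// gt_eqF//; exact: frenet_kappa hfrenet _ it.1.
have := congr1 (ev (eta S i (p i t))) (magnetic_normal it).
rewrite !evZ (eta_Phi S (pos_img it)) mulr0 => /eqP.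
by rewrite mulf_eq0 (negPf k0) => /eqP ->; rewrite mulr0.
Qed.

Lemma metric_Phi_tangent i t : times alpha i t ->
  bil (metric S i (p i t)) (T i t *m Phi S i (p i t))
    (T i t *m Phi S i (p i t)) = e1.
Proof.
move=> it; rewrite (metric_Phi S _ _ (pos_img it)) legendre// mul0r addr0.
exact: frenet_TT hfrenet i t it.
Qed.

(** Comparing squared norms in [magnetic_normal] gives kappa^2 e2 = q^2 e1, because
    g(Phi T, Phi T) = g(T, T) when eta(T) = 0. *)
Lemma magnetic_curvature i t : times alpha i t -> e2 = e1 /\ kappa t = `|q|.
Proof.
move=> it; have k0 := frenet_kappa hfrenet it.1.
have E : kappa t ^+ 2 * e2 = q ^+ 2 * e1.
  have := congr1 (fun Y => bil (metric S i (p i t)) Y Y) (magnetic_normal it).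
  rewrite /= !bilZl !bilZr metric_Phi_tangent//.
  have := frenet_NN hfrenet it; rewrite /inner => -> H.
  rewrite [q ^+ 2]expr2 -mulrA -H.
  by rewrite -[LHS]mulr1 -e2_sqr; ring.
have q2 : 0 < q ^+ 2 by rewrite exprn_even_gt0.
have k2 : 0 < kappa t ^+ 2 by rewrite exprn_gt0.
have e21 : e2 = e1.
  have [] := frenet_e2 hfrenet; have [] := frenet_e1 hfrenet => a b;
  by move: E; rewrite a b; nra.
split=> //; apply/eqP; rewrite -(@eqrXn2 _ 2) ?(ltW k0)//.
rewrite -normrX ger0_norm ?sqr_ge0//; apply/eqP.
by apply: (mulIf e2_neq0); rewrite E e21.
Qed.

(** The coefficients do not depend on [t], since kappa = |q|: this is what makes
    the binormal a constant multiple of xi, hence differentiable through xi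
    alone. *)
Lemma magnetic_frame i t : times alpha i t ->
  N i t = (e2 * Num.sg q) *: (T i t *m Phi S i (p i t)) /\
  B i t = (e2 * Num.sg q * e1) *: xi S i (p i t).
Proof.
move=> it; have [e21 k] := magnetic_curvature it.
have NE : N i t = (e2 * Num.sg q) *: (T i t *m Phi S i (p i t)).
  have q0 : `|q| != 0 by rewrite normr_eq0.
  apply: (scalerI q0); rewrite scalerA mulrCA [`|q| * _]mulrC -numEsg -scalerA.
  by rewrite -magnetic_normal// k !scalerA mulrA e2_sqr mul1r.
split=> //.
have e3E : e3 = -1.
  by apply: oppr_inj; rewrite -(frenet_sign hfrenet) e21 e1_sqr opprK.
have := frenet_TwN hfrenet it; rewrite /wedge_along /wedge e3E scaleN1r.
have -> : ev (eta S i (p i t)) (N i t) = 0.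
  by rewrite NE evZ (eta_Phi S (pos_img it)) mulr0.
rewrite legendre// !scale0r subr0 addr0 NE -scalemxAl.
rewrite (Phi2 S _ (pos_img it)) legendre// scale0r addr0 scalerN bilNr bilZr.
have := frenet_TT hfrenet it; rewrite /inner => -> /esym H.
by apply: oppr_inj; rewrite H scaleNr.
Qed.

Lemma pos_differentiable i t : times alpha i t -> differentiable (pos alpha i) t.
Proof. exact: smooth_differentiable (cfun_smooth alpha i). Qed.

Lemma derive_along_pos (V : normedModType R) (Y : 'rV[R]_3 -> V) i t :
  times alpha i t -> differentiable Y (p i t) ->
  'D_1 (Y \o pos alpha i) t = 'D_(T i t) Y (p i t).
Proof.
move=> it dY; have dp := pos_differentiable it.
rewrite (deriveE _ (differentiable_comp dp dY)) diff_comp//.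
by rewrite (deriveE _ dY) /vel derive1E (deriveE _ dp).
Qed.

Lemma cov_binormal i t : times alpha i t ->
  cov S alpha B i t = (e2 * Num.sg q * e1) *: nabla_xi S i (p i t) (T i t).
Proof.
move=> it; set c := e2 * _ * _.
have dX : differentiable (xi S i) (p i t).
  exact: smooth_differentiable (vcomp_smooth (xi S) i) (pos_img it).
have dXp : derivable (xi S i \o pos alpha i) t 1.
  apply: diff_derivable; apply: differentiable_comp => //.
  exact: pos_differentiable.
rewrite /cov /nabla_xi scalerDr !christoffel_form_mx (magnetic_frame it).2 -/c.
rewrite -scalemxAl derive1E -derive_along_pos//; congr (_ + _).
have [_ <-] := is_deriveZ c (DeriveDef dXp erefl).
apply: near_eq_derive; apply: filterS (near_times it) => s is_.
exact: (magnetic_frame is_).2.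
Qed.

(** The last Frenet equation, read through [magnetic_frame]. *)
Lemma nabla_xi_tangent i t : times alpha i t ->
  nabla_xi S i (p i t) (T i t) = tau t *: (T i t *m Phi S i (p i t)).
Proof.
move=> it; have [e21 _] := magnetic_curvature it.
have c0 : e2 * Num.sg q * e1 != 0 by rewrite -e21 !mulf_neq0// sgr_eq0.
apply: (scalerI c0); rewrite -cov_binormal// (frenet_dB hfrenet it).
by rewrite (magnetic_frame it).1 !scalerA -e21; congr (_ *: _); ring.
Qed.

Lemma magnetic_whirl_torsion i t : times alpha i t ->
  tau t = 1 - e1 * bil (metric S i (p i t)) (hop S i (p i t) (T i t)) (T i t).
Proof.
move=> it; have ip := pos_img it.
have [sG _] := metric_lorentzian S ip.
have := nabla_xi_Phi S ip (T i t) (T i t).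
rewrite nabla_xi_tangent// bilZl metric_Phi_tangent// [bil _ (T i t) _]bilC//.
move=> /(congr1 (fun r => e1 * r)); rewrite mulrCA e1_sqr mulr1 => ->.
by rewrite mulrBr e1_sqr.
Qed.

End MagneticWhirl.

Theorem proposition3p10 (R : realType) (M : manifold3 R)
    (S : contact_lorentzian M) (alpha : curve M) (e1 e2 e3 : R)
    (N B : along alpha) (kappa tau : R -> R) (q : R)
    (hfrenet : frenet S e1 e2 e3 N B kappa tau)
    (hq : q != 0)
    (hmagnetic : magnetic_trajectory S q alpha)
    (hwhirl : contact_whirl S N) :
  forall (i : idx M) (t : R), times alpha i t ->
    tau t = 1 - e1 * bil (metric S i (pos alpha i t))
                         (hop S i (pos alpha i t) (vel alpha i t))
                         (vel alpha i t).
Proof. exact: magnetic_whirl_torsion hfrenet hq hmagnetic hwhirl. Qed.
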